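(* Let $p$ be a prime, $s\ge1$, $m\ge2$. If $n>2m$, every maximum clique of the Grassmann graph $G_{p^s}(n,m)$ is a star. If $n=2m$, every maximum clique of $G_{p^s}(n,m)$ is either a star or a top.
   Context: $R=\mathbb{Z}_{p^s}$; vectors are row vectors. A set $\{\alpha_1,\dots,\alpha_k\}\subseteq R^n$ is unimodular if the matrix with rows $\alpha_i$ has a right inverse over $R$. For a submodule $V\subseteq R^n$, $\dim(V)$ is the largest size of a unimodular subset of $V$. A $k$-subspace ($k\ge1$) of $R^n$ is a submodule with a unimodular basis of $k$ vectors; the $0$-subspace is $\{0\}$. For $1\le m<n$, $G_{p^s}(n,m)$ has vertex set the $m$-subspaces of $R^n$, with $A\sim B$ iff $A\cap B$ is a linear subset of dimension $m-1$. A star is the set of all $m$-subspaces containing a fixed $(m-1)$-subspace; a top is the set of all $m$-subspaces contained in a fixed $(m+1)$-subspace. *)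

(* Defs.v *)
From HB Require Import structures.
From mathcomp Require Import all_boot all_order all_algebra.

Set Implicit Arguments.
Unset Strict Implicit.
Unset Printing Implicit Defensive.

Import GRing.Theory.

Local Open Scope ring_scope.

Section Graph.
Variables (T : finType) (e : rel T).

Definition clique (C : {set T}) : Prop :=
  {in C &, forall x y, x != y -> e x y}.

Definition maximum_clique (C : {set T}) : Prop :=
  clique C /\ forall D : {set T}, clique D -> (#|D| <= #|C|)%N.

End Graph.

Section Linear.
Variables (R : finComNzRingType) (n : nat).
Implicit Types S V : {set 'rV[R]_n}.

(* The matrix whose rows are the vectors of S; the order, that of the          *)
(* enumeration of S, is irrelevant below.                                      *)
Definition rows_mx S : 'M[R]_(#|S|, n) := \matrix_(i < #|S|) enum_val i.

Definition unimodular S : bool :=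
  [exists N : 'M[R]_(n, #|S|), rows_mx S *m N == 1%:M].

Definition submodule V : bool :=
  (0 \in V) && [forall a : R, forall x in V, forall y in V, a *: x + y \in V].

Definition udim V : nat :=
  \max_(S : {set 'rV[R]_n} | (S \subset V) && unimodular S) #|S|.

Definition lin_indep S : bool :=
  injectiveb (fun u : 'rV[R]_#|S| => u *m rows_mx S).

Definition lin_span S : {set 'rV[R]_n} :=
  [set u *m rows_mx S | u : 'rV[R]_#|S|].

Definition basis S V : bool := lin_indep S && (V == lin_span S).

(* For k = 0 the empty set is the only candidate basis, and V is then {0}:     *)
(* see subspace0.                                                              *)
Definition subspace (k : nat) V : bool :=
  submodule V &&
  [exists S : {set 'rV[R]_n}, [&& #|S| == k, unimodular S & basis S V]].

Lemma subspace0 V : subspace 0 V = (V == [set 0]).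
Proof.
have span0 : lin_span set0 = [set 0].
  apply/setP=> x; rewrite inE; apply/imsetP/eqP=> [[u _ ->]|->].
    by apply/rowP=> j; rewrite !mxE big1 // => -[i lti]; exfalso; rewrite cards0 in lti.
  by exists 0; rewrite ?mul0mx.
apply/andP/eqP=> [[_ /existsP[S /and3P[/eqP S0 _ /andP[_ /eqP->]]]]|->].
  by rewrite (cards0_eq S0) span0.
split; first apply/andP; first split; first by rewrite inE.
  apply/forallP=> a; apply/forall_inP=> x /set1P->; apply/forall_inP=> y /set1P->.
  by rewrite scaler0 addr0 inE.
apply/existsP; exists set0; rewrite cards0 eqxx /=; apply/andP; split.
  apply/existsP; exists 0; apply/eqP/matrixP=> -[i lti] j; exfalso.
  by rewrite cards0 in lti.
rewrite /basis span0 eqxx andbT; apply/injectiveP=> u v _.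
by apply/rowP=> -[i lti]; exfalso; rewrite cards0 in lti.
Qed.

End Linear.

Section Grassmann.
Variables (R : finComNzRingType) (n m : nat).

Definition grassmann : finType :=
  {V : {set 'rV[R]_n} | subspace m V}.

(* A :&: B need not be a subspace, i.e. need not have a unimodular basis.      *)
Definition grassmann_adj : rel grassmann := fun A B =>
  submodule (val A :&: val B) && (udim (val A :&: val B) == m.-1).

Definition is_star (C : {set grassmann}) : Prop :=
  exists P : {set 'rV[R]_n},
    subspace m.-1 P /\ C = [set A : grassmann | P \subset val A].

Definition is_top (C : {set grassmann}) : Prop :=
  exists Q : {set 'rV[R]_n},
    subspace m.+1 Q /\ C = [set A : grassmann | val A \subset Q].

End Grassmann.

Arguments grassmann_adj {R n m} A B.

(* Main.v *)
(** Write R = Z/p^s, k = n - m, and reduce everything modulo p.  Two members A, B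
    of a clique C with distinct reductions meet in a free summand of rank m - 1 and
    span one of rank m + 1.  If some member reduces outside A + B modulo p, then
    every member contains A :&: B, so C lies in a star; if all reduce inside A + B
    but one does not contain A :&: B modulo p, then every member lies in A + B, so C
    lies in a top.  Otherwise the reductions of C form part of a pencil, and there
    are fewer than p^2 <= p^k of them.  Finally, the members of C with a common
    reduction correspond to m x k matrices over pR with pairwise differences of
    rank at most one, and a rank-metric code built from the field with p^k elements
    bounds their number by |pR|^k.  As |pR|^k p^k = |R|^k and some star has at least
    |R|^k members, a pencil is too small, and so is a top when k > m, since fewer
    than p^(m+1) subspaces of dimension m lie in one of dimension m + 1. *)

Require Import Defs.
From HB Require Import structures.
From mathcomp Require Import all_boot all_order all_algebra all_field.

Set Implicit Arguments.
Unset Strict Implicit.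
Unset Printing Implicit Defensive.

Import GRing.Theory.

Local Open Scope ring_scope.

(** * Row spans, unimodular sets and dimension over a finite commutative ring *)

Section RowSpan.
Variable R : finComNzRingType.

Definition rspan (r n : nat) (M : 'M[R]_(r, n)) : {set 'rV[R]_n} :=
  [set u *m M | u : 'rV[R]_r].

Definition msub (r r' n : nat) (W : 'M[R]_(r, n)) (M : 'M[R]_(r', n)) : Prop :=
  exists U, W = U *m M.

Lemma rspanP r n (M : 'M[R]_(r, n)) x :
  reflect (exists u, x = u *m M) (x \in rspan M).
Proof.
by apply: (iffP imsetP) => [[u _ ->]|[u ->]]; exists u.
Qed.

Lemma msub_trans r1 r2 r3 n (B : 'M[R]_(r2, n)) (A : 'M[R]_(r1, n))
  (C : 'M[R]_(r3, n)) : msub A B -> msub B C -> msub A C.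
Proof. by case=> U -> [V ->]; exists (U *m V); rewrite mulmxA. Qed.

Lemma msub_rows r r' n (W : 'M[R]_(r, n)) (M : 'M[R]_(r', n)) :
  (forall i, row i W \in rspan M) -> msub W M.
Proof.
move=> H; have /fin_all_exists[f Hf] : forall i, exists u, row i W = u *m M.
  by move=> i; apply/rspanP.
exists (\matrix_i f i); apply/row_matrixP=> i.
by rewrite row_mul rowK Hf.
Qed.

Lemma rspan_subP r r' n (W : 'M[R]_(r, n)) (M : 'M[R]_(r', n)) :
  reflect (msub W M) (rspan W \subset rspan M).
Proof.
apply: (iffP subsetP) => [H|[U ->] x /rspanP[u ->]].
  by apply: msub_rows => i; apply: H; apply/rspanP; exists (delta_mx 0 i); rewrite -rowE.
by apply/rspanP; exists (u *m U); rewrite mulmxA.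
Qed.

Lemma rspan_eq r r' n (W : 'M[R]_(r, n)) (M : 'M[R]_(r', n)) :
  msub W M -> msub M W -> rspan W = rspan M.
Proof. by move=> h1 h2; apply/eqP; rewrite eqEsubset; apply/andP; split; apply/rspan_subP. Qed.

Lemma rows_mx_msub r n (S : {set 'rV[R]_n}) (M : 'M[R]_(r, n)) :
  S \subset rspan M -> msub (rows_mx S) M.
Proof.
by move/subsetP=> H; apply: msub_rows => i; rewrite rowK; apply/H/enum_valP.
Qed.

Lemma rspan_submodule r n (M : 'M[R]_(r, n)) : submodule (rspan M).
Proof.
apply/andP; split; first by apply/rspanP; exists 0; rewrite mul0mx.
apply/forallP=> a; apply/forall_inP=> x /rspanP[u ->].
apply/forall_inP=> y /rspanP[v ->]; apply/rspanP; exists (a *: u + v).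
by rewrite mulmxDl scalemxAl.
Qed.

Lemma submoduleI n (V W : {set 'rV[R]_n}) :
  submodule V -> submodule W -> submodule (V :&: W).
Proof.
case/andP=> V0 /forallP VD /andP[W0 /forallP WD]; apply/andP; split.
  by rewrite inE V0.
apply/forallP=> a; apply/forall_inP=> x /setIP[Vx Wx].
apply/forall_inP=> y /setIP[Vy Wy]; rewrite inE.
by rewrite (forall_inP (forall_inP (VD a) x Vx) y Vy)
           (forall_inP (forall_inP (WD a) x Wx) y Wy).
Qed.

(** The right inverse sends the rows of [M] to distinct unit vectors, so passing to the set of rows
    loses none of them. The enumeration of that set only permutes the rows. *)
Lemma unimodular_rows r n (M : 'M[R]_(r, n)) N : M *m N = 1%:M ->
  exists S : {set 'rV[R]_n}, [/\ #|S| = r, unimodular S & rspan M = lin_span S].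
Proof.
move=> MN; pose S := [set row i M | i : 'I_r].
have injM : injective (fun i => row i M).
  move=> i j /(congr1 (mulmx^~ N)); rewrite /= -!row_mul MN => /rowP/(_ j).
  by rewrite !mxE eqxx; case: eqP => // _ /eqP; rewrite eq_sym oner_eq0.
have SE (i : 'I_#|S|) : exists j, enum_val i = row j M.
  by have /imsetP[j _ ->] := enum_valP i; exists j.
have /fin_all_exists[f Hf] := SE.
have injf : injective f.
  by move=> i j fij; apply: enum_val_inj; rewrite !Hf fij.
have rowsE : rows_mx S = rowsub f M.
  by apply/row_matrixP=> i; rewrite rowK Hf; apply/rowP=> j; rewrite !mxE.
exists S; split; first by rewrite card_imset // card_ord.
  apply/existsP; exists (colsub f N); apply/eqP; rewrite rowsE.
  rewrite -mxsub_mul MN; apply/matrixP=> i j; rewrite !mxE.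
  by rewrite (inj_eq injf).
apply: rspan_eq; last by apply: rows_mx_msub; apply/subsetP=> _ /imsetP[i _ ->];
  apply/rspanP; exists (delta_mx 0 i); rewrite -rowE.
apply: msub_rows => i; apply/rspanP.
have Si : row i M \in S by apply: imset_f.
by exists (delta_mx 0 (enum_rank_in Si (row i M))); rewrite -rowE rowK enum_rankK_in.
Qed.

(** Trades sets of vectors for matrices. A right inverse already forces linear independence. *)
Lemma subspaceP k n (V : {set 'rV[R]_n}) :
  reflect (exists M : 'M[R]_(k, n), exists2 N, M *m N = 1%:M & V = rspan M)
          (subspace k V).
Proof.
apply: (iffP andP) => [[_ /existsP[S /and3P[/eqP<- /existsP[N /eqP SN]]]]|].
  by case/andP=> _ /eqP->; exists (rows_mx S); exists N.
case=> M [N MN ->]; split; first exact: rspan_submodule.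
have [S [cS uS ->]] := unimodular_rows MN.
apply/existsP; exists S; rewrite cS uS eqxx /=; apply/andP; split=> //.
have [N' /eqP SN'] := existsP uS.
by apply/injectiveP=> u v /(congr1 (mulmx^~ N')) /=; rewrite -!mulmxA SN' !mulmx1.
Qed.

Lemma leq_udim k n (W : 'M[R]_(k, n)) N (V : {set 'rV[R]_n}) :
  W *m N = 1%:M -> rspan W \subset V -> (k <= udim V)%N.
Proof.
move=> WN WV; have [S [cS uS eS]] := unimodular_rows WN; rewrite -cS.
apply: (@leq_bigmax_cond _ _ (fun S : {set 'rV[R]_n} => #|S|)); rewrite uS andbT.
apply: subset_trans WV; rewrite eS; apply/subsetP=> x Sx; apply/rspanP.
by exists (delta_mx 0 (enum_rank_in Sx x)); rewrite -rowE rowK enum_rankK_in.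
Qed.

Lemma udim_attained n (V : {set 'rV[R]_n}) :
  exists2 S : {set 'rV[R]_n}, (S \subset V) && unimodular S & #|S| = udim V.
Proof.
have h : (0 < #|[pred S : {set 'rV[R]_n} | (S \subset V) && unimodular S]|)%N.
  (* The empty set is unimodular, so the maximum ranges over a nonempty family and is attained. *)
  apply/card_gt0P; exists set0; rewrite inE sub0set; apply/existsP; exists 0.
  by apply/eqP/matrixP=> -[i lti]; exfalso; rewrite cards0 in lti.
have [S pS e] := eq_bigmax_cond (fun S : {set 'rV[R]_n} => #|S|) h.
by exists S.
Qed.

End RowSpan.

(** * Rank and counting arguments over a field *)

Section FieldRank.
Variable F : fieldType.

Lemma submx_eqrank r1 r2 n (A : 'M[F]_(r1, n)) (B : 'M[F]_(r2, n)) :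
  (A <= B)%MS -> (\rank B <= \rank A)%N -> (B <= A)%MS.
Proof. by move=> sAB; rewrite -(geq_leqif (mxrank_leqif_sup sAB)). Qed.

(** As [A] is not inside [B], the rank of their intersection is below that of [A], hence at most
    that of [W]; so [W] is the whole intersection. *)
Lemma cap_submx r r1 r2 r3 n (W : 'M[F]_(r, n)) (A : 'M[F]_(r1, n))
    (B : 'M[F]_(r2, n)) (X : 'M[F]_(r3, n)) :
  (W <= A)%MS -> (W <= B)%MS -> (\rank A <= (\rank W).+1)%N -> ~~ (A <= B)%MS ->
  (X <= A)%MS -> (X <= B)%MS -> (X <= W)%MS.
Proof.
move=> WA WB rA nAB XA XB.
have XAB : (X <= A :&: B)%MS by rewrite sub_capmx XA.
apply: (submx_trans XAB); apply: submx_eqrank; first by rewrite sub_capmx WA.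
rewrite -ltnS; apply: leq_trans rA; rewrite ltnNge; apply/negP=> le.
case/negP: nAB; apply: (submx_trans _ (capmxSr A B)).
exact: submx_eqrank (capmxSl A B) le.
Qed.

End FieldRank.

(* Such an X is cut out of Q by a nonzero functional vanishing on P and on a
   fixed complement of Q; these functionals form a space of dimension
   \rank Q - \rank P. *)
Lemma card_hyperplanes_between (F : finFieldType) (r1 r2 n : nat)
    (P : 'M[F]_(r1, n)) (Q : 'M[F]_(r2, n)) (S : {set 'M[F]_n}) :
  (P <= Q)%MS ->
  (forall X, X \in S ->
     [/\ <<X>>%MS = X, (P <= X)%MS, (X <= Q)%MS & (\rank X).+1 = \rank Q]) ->
  (#|S| < #|F| ^ (\rank Q - \rank P))%N.
Proof.
move=> PQ HS; pose B := (P + Q^C)%MS; pose Z := row_base (kermx B^T).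
have rZ : \rank (kermx B^T) = (\rank Q - \rank P)%N.
  have := mxrank_sum_cap P Q^C%MS.
  have -> : (P :&: Q^C)%MS = 0.
    by apply/eqP; rewrite -submx0 -(capmx_compl Q) capmxS.
  rewrite mxrank0 addn0 mxrank_compl => rB.
  by rewrite mxrank_ker mxrank_tr rB addnC subnDA subKn ?rank_leq_col.
pose g (u : 'rV[F]_(\rank (kermx B^T))) := <<Q :&: kermx (u *m Z)^T>>%MS.
have sub : S \subset g @: [set~ 0].
  apply/subsetP=> X /HS[eX PX XQ rX].
  have rXC : (\rank (X + Q^C)%MS < n)%N.
    apply: leq_ltn_trans (mxrank_adds_leqif X Q^C%MS).1 _; rewrite mxrank_compl.
    by rewrite -[X in (_ < X)%N](subnKC (rank_leq_col Q)) ltn_add2r -rX.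
  have : kermx (X + Q^C)%MS^T != 0.
    by rewrite -mxrank_eq0 mxrank_ker mxrank_tr -lt0n subn_gt0.
  case/rowV0Pn=> v /sub_kermxP/(congr1 trmx); rewrite trmx_mul trmxK trmx0 => Xv v0.
  have kill r' (Y : 'M_(r', n)) : (Y <= X + Q^C)%MS -> Y *m v^T = 0.
    by case/submxP=> D ->; rewrite -mulmxA Xv mulmx0.
  have : (v <= Z)%MS.
    rewrite eq_row_base; apply/sub_kermxP/trmx_inj.
    rewrite trmx_mul trmxK trmx0; apply: kill.
    by rewrite addsmxS.
  case/submxP=> u eu; apply/imsetP; exists u.
    by rewrite !inE; apply: contra v0 => /eqP u0; rewrite eu u0 mul0mx.
  rewrite /g -eu -eX; apply/genmxP.
  have XK : (X <= Q :&: kermx v^T)%MS.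
    by rewrite sub_capmx XQ; apply/sub_kermxP/kill/addsmxSl.
  rewrite XK /=; apply: submx_eqrank XK _.
  (* Otherwise [v] would vanish on all of [Q] as well as on [Q^C], hence everywhere. *)
  rewrite -ltnS rX ltnNge; apply/negP=> le.
  have /sub_kermxP Qv : (Q <= kermx v^T)%MS.
    exact: submx_trans (submx_eqrank (capmxSl _ _) le) (capmxSr _ _).
  case/eqP: v0; apply/trmx_inj; rewrite trmx0 -[v^T]mul1mx.
  have QCv : Q^C%MS *m v^T = 0 by apply/kill/addsmxSr.
  have : ((1%:M : 'M_n) <= Q + Q^C)%MS by rewrite sub1mx addsmx_compl_full.
  case/sub_addsmxP=> -[D1 D2] /= ->; rewrite mulmxDl -(mulmxA D1) -(mulmxA D2) Qv QCv.
  by rewrite !mulmx0 addr0.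
apply: leq_ltn_trans (subset_leq_card sub) _.
apply: leq_ltn_trans (leq_imset_card _ _) _.
rewrite cardsC1 card_mx mul1n rZ prednK //.
by rewrite expn_gt0; apply/orP; left; apply/card_gt0P; exists 0.
Qed.

(** * Unimodular matrices over a local ring with residue field [F] *)

Section LocalRing.
Variables (R : finComUnitRingType) (F : finFieldType) (rd : {rmorphism R -> F}).
Variable sec : F -> R.
Hypothesis secK : cancel sec rd.
Hypothesis unit_rd : forall x, rd x != 0 -> x \is a GRing.unit.

Local Notation red := (map_mx rd).
(** Independence of the rows over the residue field is equivalent to a right inverse over [R], by
    [unim_rinv] and [rinv_unim]. *)
Local Notation unim M := (row_free (red M)).

Lemma red_sec r n (A : 'M[F]_(r, n)) : red (map_mx sec A) = A.
Proof. by apply/matrixP=> i j; rewrite !mxE secK. Qed.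

Lemma unitmx_red n (M : 'M[R]_n) : red M \in unitmx -> M \in unitmx.
Proof. by rewrite !unitmxE det_map_mx unitfE; apply: unit_rd. Qed.

Lemma completion r q n (M : 'M[R]_(r, n)) : (r + q)%N = n -> unim M ->
  exists (K : 'M[R]_(q, n)) (N1 : 'M[R]_(n, r)) (N2 : 'M[R]_(n, q)),
  [/\ N1 *m M + N2 *m K = 1%:M, M *m N1 = 1%:M, M *m N2 = 0,
      K *m N1 = 0 & K *m N2 = 1%:M].
Proof.
move=> en; move: M; rewrite -{n}en => M uM.
have [Kb HKb] : exists Kb : 'M[F]_(q, r + q), (Kb :=: (red M)^C)%MS.
  have e : \rank (red M)^C = q.
    by rewrite mxrank_compl (eqP uM) addKn.
  by move: (row_base (red M)^C%MS) (eq_row_base (red M)^C%MS); rewrite e => Kb h; exists Kb.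
pose K := map_mx sec Kb; pose G := col_mx M K.
have uG : G \in unitmx.
  apply: unitmx_red; rewrite map_col_mx red_sec -row_full_unit.
  rewrite -sub1mx -addsmxE (adds_eqmx (eqmx_refl _) HKb) sub1mx.
  exact: addsmx_compl_full.
exists K, (lsubmx (invmx G)), (rsubmx (invmx G)).
have := mulmxV uG; rewrite -{1}(hsubmxK (invmx G)) mul_col_row scalar_mx_block.
case/eq_block_mx=> -> -> -> ->; split=> //.
by rewrite -mul_row_col hsubmxK -scalar_mx_block; exact: mulVmx.
Qed.

Lemma unim_leq r n (M : 'M[R]_(r, n)) : unim M -> (r <= n)%N.
Proof. by move/eqP <-; apply: rank_leq_col. Qed.

Lemma unim_rinv r n (M : 'M[R]_(r, n)) : unim M -> exists N, M *m N = 1%:M.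
Proof.
move=> uM; have [K [N1 [N2 [_ MN _ _ _]]]] := completion (subnKC (unim_leq uM)) uM.
by exists N1.
Qed.

Lemma rinv_unim r n (M : 'M[R]_(r, n)) N : M *m N = 1%:M -> unim M.
Proof.
move/(congr1 (fun A => red A)); rewrite map_mxM map_mx1 => e.
by apply/row_freeP; exists (red N).
Qed.

Lemma full_linv r n (U : 'M[R]_(r, n)) : row_full (red U) -> exists L, L *m U = 1%:M.
Proof.
rewrite /row_full -mxrank_tr map_trmx => /unim_rinv[N /(congr1 trmx)].
by rewrite trmx_mul trmxK trmx1; exists N^T.
Qed.

Lemma msub_red r r' n (W : 'M[R]_(r, n)) (M : 'M[R]_(r', n)) :
  msub W M -> (red W <= red M)%MS.
Proof. by case=> U ->; rewrite map_mxM submxMl. Qed.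

Lemma unim_mull r r' n (U : 'M[R]_(r, r')) (M : 'M[R]_(r', n)) :
  unim (U *m M) -> unim U.
Proof.
rewrite /row_free map_mxM => /eqP e; rewrite eqn_leq rank_leq_row /=.
by apply: leq_trans (mxrankM_maxl _ (red M)); rewrite e.
Qed.

(** The matrix of coefficients is square and invertible modulo the maximal ideal, hence
    invertible. *)
Lemma msub_eqrank r n (W M : 'M[R]_(r, n)) : msub W M -> unim W -> msub M W.
Proof.
case=> U -> /unim_mull; rewrite row_free_unit => /unitmx_red uU.
by exists (invmx U); rewrite mulKmx.
Qed.

Lemma hyperplane_split r n (W : 'M[R]_(r, n)) (Y : 'M[R]_(r.+1, n)) :
  unim W -> msub W Y ->
  exists (y : 'rV[R]_n) (N1 : 'M_(r.+1, r)) (N2 : 'M_(r.+1, 1)),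
    Y = N1 *m W + N2 *m y.
Proof.
move=> uW [U eW]; have uU : unim U by apply: (@unim_mull _ _ _ _ Y); rewrite -eW.
have [K [N1 [N2 [e _ _ _ _]]]] := completion (addn1 r) uU.
by exists (K *m Y), N1, N2; rewrite eW !mulmxA -mulmxDl e mul1mx.
Qed.

(** [B] is generated by [W] and one further vector [y]; putting [y] on top of [A] gives [Q], and
    [red B] outside [red A] gives it full rank. *)
Lemma sum_unim r n (A B : 'M[R]_(r.+1, n)) (W : 'M[R]_(r, n)) :
  unim A -> unim W -> msub W A -> msub W B -> ~~ (red B <= red A)%MS ->
  exists Q : 'M[R]_(r.+2, n),
    [/\ unim Q, msub A Q & msub B Q].
Proof.
move=> uA uW [U eU] WB nBA.
have [y [N1 [N2 eB]]] := hyperplane_split uW WB.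
pose Q : 'M[R]_(1 + r.+1, n) := col_mx y A.
have AQ : msub A Q.
  by exists (row_mx 0 1%:M); rewrite mul_row_col mul0mx mul1mx add0r.
have BQ : msub B Q.
  exists (row_mx N2 (N1 *m U)); rewrite mul_row_col -mulmxA -eU.
  by rewrite addrC.
exists Q; split=> //.
have sub : (red A + red B <= red Q)%MS by rewrite addsmx_sub !msub_red.
rewrite /row_free eqn_leq rank_leq_row; apply: leq_trans (mxrankS sub).
rewrite ltnNge; apply/negP=> le; case/negP: nBA.
apply: (submx_trans (addsmxSr (red A) _)); apply: submx_eqrank (addsmxSl _ _) _.
by rewrite (eqP uA).
Qed.

(** Counterpart of [cap_submx] over [R]. The map [e] kills [Q], while [y *m e] has a unit entry, so
    a vector of [Y] lying in [Q] has zero coefficient along [y]. *)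
Lemma cap_msub r q n (W W' : 'M[R]_(r, n)) (Y : 'M[R]_(r.+1, n)) (Q : 'M[R]_(q, n)) :
  unim W -> msub W Y -> msub W Q -> unim Q -> ~~ (red Y <= red Q)%MS ->
  msub W' Y -> msub W' Q -> msub W' W.
Proof.
move=> uW WY WQ /unim_rinv[NQ QN] nYQ [V eV] [V' eV'].
have [y [N1 [N2 eY]]] := hyperplane_split uW WY.
pose e := 1%:M - NQ *m Q.
have Qe : Q *m e = 0 by rewrite mulmxBr mulmx1 mulmxA QN mul1mx subrr.
have We : W *m e = 0 by case: WQ => V1 ->; rewrite -mulmxA Qe mulmx0.
have /rV0Pn[j yj] : red (y *m e) != 0.
  apply: contra nYQ => /eqP ye; have : red (Y *m e) = 0.
    by rewrite eY mulmxDl -!mulmxA We mulmx0 add0r map_mxM ye mulmx0.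
  rewrite mulmxBr mulmx1 mulmxA map_mxB => /eqP; rewrite subr_eq0 => /eqP ->.
  by rewrite map_mxM submxMl.
rewrite mxE in yj; have uy := unit_rd yj; clearbody e.
suff V0 : V *m N2 = 0 by exists (V *m N1); rewrite eV eY mulmxDr !mulmxA V0 mul0mx addr0.
have h : (V *m N2) *m (y *m e) = 0.
  have : W' *m e = 0 by rewrite eV' -mulmxA Qe mulmx0.
  by rewrite eV eY mulmxDr mulmxDl -!mulmxA We !mulmx0 add0r.
apply/colP=> i; have /matrixP/(_ i j) := h; rewrite [LHS]mxE big_ord1 [RHS]mxE => e0.
by rewrite [RHS]mxE; apply: (mulIr uy); rewrite mul0r.
Qed.

(** * Structure of cliques according to their reductions *)

Section Trichotomy.
Variables (I : finType) (r n : nat) (M : I -> 'M[R]_(r.+1, n)).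
Hypothesis uM : forall i, unim (M i).
Hypothesis adjM : forall i j, ~~ (red (M j) <= red (M i))%MS ->
  exists W : 'M[R]_(r, n), [/\ unim W, msub W (M i) & msub W (M j)].

Let redM_sym i j : (red (M i) <= red (M j))%MS -> (red (M j) <= red (M i))%MS.
Proof. by move/submx_eqrank; apply; rewrite (eqP (uM i)) (eqP (uM j)). Qed.

Let adjM' i j : ~~ (red (M i) <= red (M j))%MS ->
  exists W : 'M[R]_(r, n), [/\ unim W, msub W (M i) & msub W (M j)].
Proof. by move=> h; apply: adjM; apply: contra h; apply: redM_sym. Qed.

Let rank_unim k (W : 'M[R]_(k, n)) : unim W -> \rank (red W) = k.
Proof. by move/eqP. Qed.

(* The traces of M a and M b on M y both equal that of Q, so they coincide and
   lie in the intersection W of M a and M b. *)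
Let star_step a b y (W : 'M[R]_(r, n)) (Q : 'M[R]_(r.+2, n)) :
  unim W -> msub W (M a) -> msub W (M b) -> ~~ (red (M b) <= red (M a))%MS ->
  unim Q -> msub (M a) Q -> msub (M b) Q -> ~~ (red (M y) <= red Q)%MS ->
  msub W (M y).
Proof.
move=> uW Wa Wb nba uQ aQ bQ nyQ.
have [W1 [uW1 W1y W1a]] :
    exists W : 'M[R]_(r, n), [/\ unim W, msub W (M y) & msub W (M a)].
  by apply: adjM'; apply: contra nyQ => h; apply: submx_trans h (msub_red aQ).
have [W2 [uW2 W2y W2b]] :
    exists W : 'M[R]_(r, n), [/\ unim W, msub W (M y) & msub W (M b)].
  by apply: adjM'; apply: contra nyQ => h; apply: submx_trans h (msub_red bQ).
have W12 : msub W1 W2.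
  by apply: cap_msub uW2 W2y (msub_trans W2b bQ) uQ nyQ W1y (msub_trans W1a aQ).
have W1W : msub W1 W.
  exact: cap_msub uW Wb Wa (uM a) nba (msub_trans W12 W2b) W1a.
exact: msub_trans (msub_eqrank W1W uW1) W1y.
Qed.

(** The traces [W1] and [W2] of [M y] on [M a] and [M b] differ after reduction: otherwise both
    would reduce to [W], which [M y] does not contain. Hence they generate [M y] over [R]. *)
Let top_step q a b y (W : 'M[R]_(r, n)) (Q : 'M[R]_(q, n)) :
  unim W -> msub W (M a) -> msub W (M b) -> ~~ (red (M b) <= red (M a))%MS ->
  msub (M a) Q -> msub (M b) Q -> ~~ (red W <= red (M y))%MS ->
  msub (M y) Q.
Proof.
move=> uW Wa Wb nba aQ bQ nWy.
have [W1 [uW1 [U1 eU1] W1a]] :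
    exists W : 'M[R]_(r, n), [/\ unim W, msub W (M y) & msub W (M a)].
  by apply: adjM; apply: contra nWy => h; apply: submx_trans h; apply: msub_red.
have [W2 [uW2 [U2 eU2] W2b]] :
    exists W : 'M[R]_(r, n), [/\ unim W, msub W (M y) & msub W (M b)].
  by apply: adjM; apply: contra nWy => h; apply: submx_trans h; apply: msub_red.
have W1y : (red W1 <= red (M y))%MS by apply: msub_red; exists U1.
have W2y : (red W2 <= red (M y))%MS by apply: msub_red; exists U2.
have n12 : ~~ (red W1 <= red W2)%MS.
  apply: contra nWy => W12.
  suff W1W : (red W1 <= red W)%MS.
    by apply: submx_trans W1y; apply: submx_eqrank W1W _; rewrite !rank_unim.
  apply: cap_submx (msub_red Wb) (msub_red Wa) _ nba _ (msub_red W1a).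
    by rewrite !rank_unim.
  exact: submx_trans W12 (msub_red W2b).
have /full_linv[L e] : row_full (red (col_mx U1 U2)).
  rewrite /row_full eqn_leq rank_leq_col /=.
  apply: leq_trans (mxrankM_maxl _ (red (M y))).
  rewrite -map_mxM mul_col_mx -eU1 -eU2 map_col_mx -addsmxE.
  rewrite ltnNge; apply: contra n12 => le.
  apply: submx_trans (addsmxSl _ (red W2)) _.
  by apply: submx_eqrank (addsmxSr _ _) _; rewrite (rank_unim uW2).
have [V1 eV1] := msub_trans W1a aQ; have [V2 eV2] := msub_trans W2b bQ.
exists (L *m col_mx V1 V2).
by rewrite -mulmxA mul_col_mx -eV1 -eV2 eU1 eU2 -mul_col_mx mulmxA e mul1mx.
Qed.

(** The star and top alternatives hold over [R]; the other two, a single reduction and a pencil,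
    concern reductions only and are left to counting. *)
Lemma clique_trichotomy :
  [\/ exists2 P : 'M[R]_(r, n), unim P & forall i, msub P (M i),
      exists2 Q : 'M[R]_(r.+2, n), unim Q & forall i, msub (M i) Q,
      forall i j, (red (M i) <= red (M j))%MS |
      exists (P : 'M[F]_(r, n)) (Q : 'M[F]_(r.+2, n)),
        [/\ row_free P, row_free Q & forall i, (P <= red (M i))%MS /\ (red (M i) <= Q)%MS]].
Proof.
have [/'forall_forallP h|] := boolP [forall i, forall j, (red (M i) <= red (M j))%MS].
  by constructor 3.
rewrite negb_forall => /existsP[b]; rewrite negb_forall => /existsP[a nba].
have [W [uW Wa Wb]] := adjM nba.
have [Q [uQ aQ bQ]] := sum_unim (uM a) uW Wa Wb nba.
have nab : ~~ (red (M a) <= red (M b))%MS by apply: contra nba; apply: redM_sym.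
have [/forallP inQ|] := boolP [forall i, (red (M i) <= red Q)%MS]; last first.
  rewrite negb_forall => /existsP[x nxQ]; constructor 1; exists W => // y.
  have nxa : ~~ (red (M x) <= red (M a))%MS.
    by apply: contra nxQ => h; apply: submx_trans h (msub_red aQ).
  have nxb : ~~ (red (M x) <= red (M b))%MS.
    by apply: contra nxQ => h; apply: submx_trans h (msub_red bQ).
  have Wx := star_step uW Wa Wb nba uQ aQ bQ nxQ.
  (* [W] also lies in [M x], so any of the pairs (a, b), (a, x), (b, x) can serve in [star_step]. If
     [M y] reduced inside all three sums, it would reduce to both [M a] and [M b]. *)
  have [yQ|] := boolP (red (M y) <= red Q)%MS; last exact: star_step uW Wa Wb nba uQ aQ bQ.
  have [Q2 [uQ2 aQ2 xQ2]] := sum_unim (uM a) uW Wa Wx nxa.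
  have [yQ2|] := boolP (red (M y) <= red Q2)%MS;
    last exact: star_step uW Wa Wx nxa uQ2 aQ2 xQ2.
  have [Q3 [uQ3 bQ3 xQ3]] := sum_unim (uM b) uW Wb Wx nxb.
  apply: (star_step uW Wb Wx nxb uQ3 bQ3 xQ3); apply: contra nab => yQ3.
  have key c (Q' : 'M[R]_(r.+2, n)) :
      unim Q' -> msub (M c) Q -> msub (M c) Q' -> msub (M x) Q' ->
      (red (M y) <= red Q')%MS -> (red (M y) <= red (M c))%MS.
    move=> uQ' cQ cQ' xQ' yQ'.
    apply: cap_submx (msub_red cQ') (msub_red cQ) _ _ yQ' yQ.
      by rewrite (rank_unim uQ') (rank_unim (uM c)).
    by apply: contra nxQ; apply: submx_trans; apply: msub_red.
  exact: submx_trans (redM_sym (key _ _ uQ2 aQ aQ2 xQ2 yQ2)) (key _ _ uQ3 bQ bQ3 xQ3 yQ3).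
have [/forallP inW|] := boolP [forall i, (red W <= red (M i))%MS].
  by constructor 4; exists (red W), (red Q); split.
rewrite negb_forall => /existsP[x nWx]; constructor 2; exists Q => // y.
have xQ := top_step uW Wa Wb nba aQ bQ nWx.
(* The same three pairs all have their sum in [Q]. If [M y] contained all three intersections modulo
   the maximal ideal, [W] would reduce inside [M x]. *)
have [Wy|] := boolP (red W <= red (M y))%MS; last exact: top_step uW Wa Wb nba aQ bQ.
have nxa : ~~ (red (M x) <= red (M a))%MS.
  apply: contra nWx => /redM_sym h; apply: submx_trans h; exact: msub_red.
have nxb : ~~ (red (M x) <= red (M b))%MS.
  apply: contra nWx => /redM_sym h; apply: submx_trans h; exact: msub_red.
have [W2 [uW2 W2a W2x]] := adjM nxa.
have [W2y|] := boolP (red W2 <= red (M y))%MS; last exact: top_step uW2 W2a W2x nxa aQ xQ.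
have [W3 [uW3 W3b W3x]] := adjM nxb.
apply: (top_step uW3 W3b W3x nxb bQ xQ); apply: contra nWx => W3y.
have [ya|nya] := boolP (red (M y) <= red (M a))%MS.
  have W3W : (red W3 <= red W)%MS.
    apply: cap_submx (msub_red Wb) (msub_red Wa) _ nba (msub_red W3b) (submx_trans W3y ya).
    by rewrite !rank_unim.
  apply: submx_trans (msub_red W3x); apply: submx_eqrank W3W _.
  by rewrite !rank_unim.
apply: submx_trans (msub_red W2x).
apply: cap_submx W2y (msub_red W2a) _ nya Wy (msub_red Wa).
by rewrite !rank_unim.
Qed.

End Trichotomy.

(** * Counting clique members with a common reduction *)

Definition redker k : {set 'rV[R]_k} := [set v | red v == 0].

(** Adding lifts of vectors over [F] to vectors of the kernel is injective. *)
Lemma card_redker k :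
  (#|redker k| * #|F| ^ k <= #|R| ^ k)%N.
Proof.
rewrite -[X in (#|F| ^ X)%N]mul1n -[X in (#|R| ^ X)%N]mul1n -!card_mx.
rewrite -[#|{: 'rV[F]_k}|]cardsT -cardsX.
pose f (x : 'rV[R]_k * 'rV[F]_k) := x.1 + map_mx sec x.2.
rewrite -(card_in_imset (f := f)) ?max_card // => -[v w] [v' w'].
rewrite !inE /f /= !andbT => /eqP v0 /eqP v0' e.
have ew : w = w'.
  by have /(congr1 (fun A => red A)) := e; rewrite !map_mxD v0 v0' !add0r !red_sec.
by move: e; rewrite ew => /addIr->.
Qed.

Section FibreBound.
Variables (r k n : nat) (T : 'I_r.+1 -> 'M[F]_k).
Hypothesis enk : (r.+1 + k)%N = n.
Hypothesis unitT : forall u : 'cV[F]_r.+1, u != 0 -> \sum_l u l 0 *: T l \in unitmx.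

Variables (I : finType) (M : I -> 'M[R]_(r.+1, n)) (i0 : I).
Hypothesis uM : forall i, unim (M i).
Hypothesis adjM : forall i j, i != j ->
  exists W : 'M[R]_(r, n), [/\ unim W, msub W (M i) & msub W (M j)].
Hypothesis injM : forall i j, msub (M i) (M j) -> i = j.
Hypothesis redM : forall i, (red (M i) <= red (M i0))%MS.

(* All M i are graphs of maps X : M i0 -> R^k vanishing modulo the maximal ideal,
   pairwise differing by matrices c *m x with c unimodular; the linear map
   X |-> \sum_l X_l T_l is injective on such matrices. *)
Lemma fibre_bound : (#|I| <= #|redker k|)%N.
Proof.
have [K [N1 [N2 [eN MN1 MN2 KN1 KN2]]]] := completion enk (uM i0).
have graph i : exists X : 'M[R]_(r.+1, k),
    [/\ red X = 0, msub (M i) (M i0 + X *m K) & msub (M i0 + X *m K) (M i)].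
  have eM : M i = (M i *m N1) *m M i0 + (M i *m N2) *m K.
    by rewrite -!mulmxA -mulmxDr eN mulmx1.
  have redN2 : red (M i *m N2) = 0.
    have /submxP[D eD] := redM i.
    by rewrite map_mxM eD -mulmxA -map_mxM MN2 map_mx0 mulmx0.
  (* The component of [M i] along [K] vanishes modulo the maximal ideal, so the one along [M i0]
     carries the full rank. *)
  have uU : M i *m N1 \in unitmx.
    apply: unitmx_red; rewrite -row_free_unit.
    apply: (@unim_mull _ _ _ _ (M i0)).
    have : unim (M i) by [].
    by rewrite {1}eM map_mxD [red (_ *m K)]map_mxM redN2 mul0mx addr0.
  exists (invmx (M i *m N1) *m (M i *m N2)).
  have e : M i0 + invmx (M i *m N1) *m (M i *m N2) *m K = invmx (M i *m N1) *m M i.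
    by rewrite [X in _ = _ *m X]eM mulmxDr mulKmx // !mulmxA.
  split; first by rewrite map_mxM redN2 mulmx0.
    by exists (M i *m N1); rewrite e mulKVmx.
  by exists (invmx (M i *m N1)).
have /fin_all_exists[X HX] := graph.
pose Phi (Y : 'M[R]_(r.+1, k)) := \sum_l row l Y *m map_mx sec (T l).
have PhiB Y Z : Phi (Y - Z) = Phi Y - Phi Z.
  by rewrite -sumrB; apply: eq_bigr => l _; rewrite linearB mulmxBl.
pose f i := Phi (X i).
have injf : injective f.
  move=> i j fij; apply/eqP/negPn/negP => nij.
  have [W [uW [V1 eV1] [V2 eV2]]] := adjM nij.
  have [_ [D1 eD1] [D1' eD1']] := HX i; have [_ [D2 eD2] [D2' eD2']] := HX j.
  pose U1 := V1 *m D1; pose U2 := V2 *m D2.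
  have e1 : W = U1 *m (M i0 + X i *m K) by rewrite eV1 {1}eD1 mulmxA.
  have e2 : W = U2 *m (M i0 + X j *m K) by rewrite eV2 {1}eD2 mulmxA.
  clearbody U1 U2.
  have graphN1 Y : (M i0 + Y *m K) *m N1 = 1%:M.
    by rewrite mulmxDl -mulmxA KN1 mulmx0 addr0.
  have graphN2 Y : (M i0 + Y *m K) *m N2 = Y.
    by rewrite mulmxDl -mulmxA KN2 mulmx1 MN2 add0r.
  (* Multiplying by [N1] reads off the coefficients of [W] in either graph; they agree, so they
     annihilate [X i - X j]. *)
  have e12 : U1 = U2.
    by rewrite -[U1]mulmx1 -[U2]mulmx1 -{1}(graphN1 (X i)) -(graphN1 (X j)) !mulmxA -e1 -e2.
  have eX : U1 *m (X i - X j) = 0.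
    rewrite mulmxBr -[in X in X - _](graphN2 (X i)) -[in X in _ - X](graphN2 (X j)).
    by rewrite !mulmxA -e1 e12 -e2 subrr.
  have uU1 : unim U1 by apply: (@unim_mull _ _ _ _ (M i0 + X i *m K)); rewrite -e1.
  (* The columns killed by [U1] are multiples of the single column [N2'], whence the rank one shape
     of the difference. *)
  have [K' [N1' [N2' [eN' _ _ _ KN2']]]] := completion (addn1 r) uU1.
  pose x := K' *m (X i - X j).
  have eD : X i - X j = N2' *m x.
    by rewrite -[LHS]mul1mx -eN' mulmxDl -!mulmxA eX mulmx0 add0r.
  have x0 : x = 0.
    (* [Phi] maps [N2' *m x] to [x *m G], and [G] is invertible because [N2'] has nonzero
       reduction. *)
    pose G := \sum_l N2' l 0 *: map_mx sec (T l).
    have uG : G \in unitmx.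
      apply: unitmx_red; rewrite raddf_sum /=.
      rewrite (eq_bigr (fun l => red N2' l 0 *: T l)); last first.
        by move=> l _; rewrite map_mxZ red_sec mxE.
      apply: unitT; apply/eqP=> N0; have /(congr1 (fun A => red A)) := KN2'.
      rewrite map_mxM N0 mulmx0 map_mx1 => /matrixP/(_ 0 0); rewrite !mxE => /eqP.
      by rewrite eq_sym oner_eq0.
    have : Phi (X i - X j) = 0 by rewrite PhiB; apply/eqP; rewrite subr_eq0; apply/eqP.
    rewrite eD /Phi => h; have : x *m G = 0.
      rewrite -h /G mulmx_sumr; apply: eq_bigr => l _.
      by rewrite row_mul [row l N2']mx11_scalar mul_scalar_mx mxE -scalemxAl -scalemxAr.
    by move/(congr1 (mulmx^~ (invmx G))); rewrite mulmxK // mul0mx.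
  case/negP: nij; apply/eqP/injM; have [_ _ h] := HX j; have [_ h' _] := HX i.
  apply: msub_trans h' _; have -> // : X i = X j.
  by apply/eqP; rewrite -subr_eq0 eD x0 mulmx0.
rewrite -(card_imset _ injf); apply: subset_leq_card; apply/subsetP=> _ /imsetP[i _ ->].
rewrite inE raddf_sum /=; apply/eqP; apply: big1 => l _; have [X0 _ _] := HX i.
by rewrite map_mxM map_row X0 row0 mul0mx.
Qed.

End FibreBound.

(** * Adjacency, stars and tops in terms of matrices *)

Section Cliques.
Variables r n : nat.
Local Notation G := (grassmann R n r.+1).

Lemma gmx_exists (A : G) : exists M : 'M[R]_(r.+1, n), unim M && (val A == rspan M).
Proof.
have /subspaceP[M [N MN ->]] := valP A.
by exists M; rewrite (rinv_unim MN) eqxx.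
Qed.

Definition gmx (A : G) : 'M[R]_(r.+1, n) := xchoose (gmx_exists A).

Lemma gmx_unim A : unim (gmx A).
Proof. by case/andP: (xchooseP (gmx_exists A)). Qed.

Lemma gmxE A : val A = rspan (gmx A).
Proof. by case/andP: (xchooseP (gmx_exists A)) => _ /eqP. Qed.

Lemma unim_subspace q (M : 'M[R]_(q, n)) : unim M -> subspace q (rspan M).
Proof. by case/unim_rinv=> N MN; apply/subspaceP; exists M, N. Qed.

Lemma gmx_inj A B : msub (gmx A) (gmx B) -> A = B.
Proof.
move=> AB; apply: val_inj; rewrite !gmxE; apply: rspan_eq => //.
exact: msub_eqrank AB (gmx_unim A).
Qed.

Lemma unimodular_cap (A B : G) (S : {set 'rV[R]_n}) q :
  S \subset val A :&: val B -> unimodular S -> #|S| = q ->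
  exists W : 'M[R]_(q, n), [/\ unim W, msub W (gmx A) & msub W (gmx B)].
Proof.
rewrite subsetI !gmxE => /andP[SA SB] /existsP[N /eqP SN] <-.
by exists (rows_mx S); split; [exact: rinv_unim SN|exact: rows_mx_msub|exact: rows_mx_msub].
Qed.

Lemma adj_unim (A B : G) : grassmann_adj A B ->
  exists W : 'M[R]_(r, n), [/\ unim W, msub W (gmx A) & msub W (gmx B)].
Proof.
case/andP=> _ /eqP e; have [S /andP[SAB uS] cS] := udim_attained (val A :&: val B).
by apply: unimodular_cap SAB uS _; rewrite cS e.
Qed.

(** [W] bounds the dimension of the intersection from below; a unimodular family of [r.+1] vectors
    in it would generate both [A] and [B]. *)
Lemma unim_adj (A B : G) (W : 'M[R]_(r, n)) : A != B -> unim W ->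
  msub W (gmx A) -> msub W (gmx B) -> grassmann_adj A B.
Proof.
move=> nAB uW WA WB; apply/andP; split.
  by rewrite !gmxE; apply: submoduleI; apply: rspan_submodule.
rewrite eqn_leq; apply/andP; split; last first.
  have [N WN] := unim_rinv uW; apply: leq_udim WN _.
  by rewrite subsetI !gmxE; apply/andP; split; apply/rspan_subP.
have [S /andP[SAB uS] <-] := udim_attained (val A :&: val B).
have [W1 [uW1 [U eU] _]] := unimodular_cap SAB uS erefl.
rewrite -ltnS ltn_neqAle; apply/andP; split; last first.
  by apply: (@unim_leq _ _ U); apply: (@unim_mull _ _ _ _ (gmx A)); rewrite -eU.
apply: contra nAB => /eqP cS; have [W2 [uW2 W2A W2B]] := unimodular_cap SAB uS cS.
by apply/eqP/gmx_inj; apply: msub_trans W2B; apply: msub_eqrank.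
Qed.

Lemma star_clique (P : 'M[R]_(r, n)) : unim P ->
  clique grassmann_adj [set A : G | rspan P \subset val A].
Proof.
move=> uP A B; rewrite !inE !gmxE => /rspan_subP PA /rspan_subP PB nAB.
exact: unim_adj uP PA PB.
Qed.

Hypothesis chainR : forall q (f : 'I_q.+1 -> R),
  exists i, forall j, exists c, f j = c * f i.

(* Modulo A, the subspace Q is free of rank one, so B :&: A is the kernel of a
   functional f on B; if f i divides every f j, this kernel contains the
   unimodular family of the e_j - (f j / f i) e_i for j != i. *)
Lemma top_clique (Q : 'M[R]_(r.+2, n)) : unim Q ->
  clique grassmann_adj [set A : G | val A \subset rspan Q].
Proof.
move=> uQ A B; rewrite !inE !gmxE => /rspan_subP[UA eA] /rspan_subP[UB eB] nAB.
have uUA : unim UA.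
  by apply: (@unim_mull _ _ _ _ Q); rewrite -eA gmx_unim.
have [K [N1 [N2 [eN _ _ _ _]]]] := completion (addn1 r.+1) uUA.
have [f ef] : exists f, f = UB *m N2 by exists (UB *m N2).
have [i Hi] := chainR (fun j => f j 0).
have /fin_all_exists[c Hc] := Hi.
pose C := \col_j c j; pose E : 'M[R]_r.+1 := 1%:M - C *m delta_mx 0 i.
have Ef : E *m f = 0.
  rewrite mulmxBl mul1mx -mulmxA -rowE; apply/colP=> j.
  by rewrite !mxE big_ord1 !mxE -Hc subrr.
pose V := rowsub (lift i) E; pose N : 'M[R]_(r.+1, r) := colsub (lift i) 1%:M.
have VN : V *m N = 1%:M.
  rewrite mul_rowsub_mx mulmxBl mul1mx -mulmxA -rowE.
  apply/matrixP=> l l'; rewrite !mxE big_ord1 !mxE.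
  by rewrite (inj_eq lift_inj) (negbTE (neq_lift i l')) mulr0 subr0.
have Vf : V *m f = 0 by rewrite mul_rowsub_mx Ef; apply/matrixP=> l j; rewrite !mxE.
have [NB BN] := unim_rinv (gmx_unim B).
apply: (@unim_adj A B (V *m gmx B)) => //.
- by apply: (@rinv_unim _ _ _ (NB *m N)); rewrite -mulmxA (mulmxA (gmx B)) BN mul1mx.
- exists (V *m UB *m N1); rewrite eB eA !mulmxA; congr (_ *m Q).
  by rewrite -[LHS]mulmx1 -eN mulmxDr !mulmxA -(mulmxA V UB N2) -ef Vf mul0mx addr0.
- by exists V.
Qed.

(** Partitions [C] by reduction and applies [fibre_bound] to each class. *)
Lemma clique_card k (T : 'I_r.+1 -> 'M[F]_k) (C : {set G}) :
  (r.+1 + k)%N = n ->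
  (forall u : 'cV[F]_r.+1, u != 0 -> \sum_l u l 0 *: T l \in unitmx) ->
  clique grassmann_adj C ->
  (#|C| <= #|[set <<red (gmx A)>>%MS | A in C]| * #|redker k|)%N.
Proof.
move=> enk unitT cC; rewrite -sum1_card (partition_big_imset (fun A => <<red (gmx A)>>%MS)).
rewrite -sum_nat_const; apply: leq_sum => b /imsetP[A0 CA0 eb].
rewrite sum1_card -card_sig.
have A0P : (A0 \in C) && (<<red (gmx A0)>>%MS == b) by rewrite CA0 eb eqxx.
apply: (@fibre_bound r k n T enk unitT _ (fun A => gmx (val A)) (exist _ A0 A0P)).
- by move=> A; apply: gmx_unim.
- move=> A B nAB; apply/adj_unim/cC => //; first by case/andP: (valP A).
  by case/andP: (valP B).
- by move=> A B /gmx_inj/val_inj.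
by move=> A; have /andP[_ /eqP eA] := valP A; have /genmxP/andP[] := etrans eA eb.
Qed.

End Cliques.

(** * Maximum cliques by comparison with a large star *)

(** The members exhibited are graphs of the maps sending the first basis vector to an arbitrary [w]
    and the others to zero; all contain those other basis vectors. *)
Lemma large_star r k : exists2 P : 'M[R]_(r, r.+1 + k), unim P &
  (#|R| ^ k <= #|[set A : grassmann R (r.+1 + k) r.+1 | rspan P \subset val A]|)%N.
Proof.
pose U : 'M[R]_(r, r.+1) := rowsub (lift 0) 1%:M.
pose c0 : 'cV[R]_r.+1 := delta_mx 0 0.
pose A w : 'M[R]_(r.+1, r.+1 + k) := row_mx 1%:M (c0 *m w).
have Uc0 : U *m c0 = 0.
  by rewrite mul_rowsub_mx mul1mx; apply/matrixP=> i j; rewrite !mxE.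
have UU : U *m U^T = 1%:M.
  rewrite mul_rowsub_mx mul1mx; apply/matrixP=> i j; rewrite !mxE.
  by rewrite (inj_eq lift_inj) eq_sym.
have uA w : unim (A w).
  by apply: (@rinv_unim _ _ _ (col_mx 1%:M 0)); rewrite mul_row_col mulmx1 mulmx0 addr0.
have /fin_all_exists[h Hh] : forall w,
    exists B : grassmann R (r.+1 + k) r.+1, val B = rspan (A w).
  by move=> w; exists (exist (fun V => subspace r.+1 V) _ (unim_subspace (uA w))).
have injh : injective h.
  move=> w w' e; have : msub (A w) (A w') by apply/rspan_subP; rewrite -!Hh e.
  case=> V; rewrite mul_mx_row mulmx1 => /eq_row_mx[<-]; rewrite mul1mx.
  move/matrixP=> ew; apply/rowP=> j; have := ew 0 j.
  by rewrite !mxE !big_ord1 !mxE eqxx !mul1r.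
exists (row_mx U 0).
  by apply: (@rinv_unim _ _ _ (col_mx U^T 0)); rewrite mul_row_col UU mulmx0 addr0.
rewrite -[k in (#|R| ^ k)%N]mul1n -card_mx -(card_imset _ injh).
apply: subset_leq_card; apply/subsetP=> _ /imsetP[w _ ->]; rewrite inE Hh.
apply/rspan_subP; exists U.
by rewrite mul_mx_row mulmx1 mulmxA Uc0 mul0mx.
Qed.

Lemma maximum_clique_star_or_top r k (T : 'I_r.+1 -> 'M[F]_k)
    (C : {set grassmann R (r.+1 + k) r.+1}) :
  (forall q (f : 'I_q.+1 -> R), exists i, forall j, exists c, f j = c * f i) ->
  (forall u : 'cV[F]_r.+1, u != 0 -> \sum_l u l 0 *: T l \in unitmx) ->
  (1 < k)%N -> maximum_clique grassmann_adj C ->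
  is_star C \/ (is_top C /\ (k <= r.+1)%N).
Proof.
move=> chainR unitT k_gt1 [cC maxC].
pose S := [set <<red (gmx A)>>%MS | A in C].
have bigC : (#|R| ^ k <= #|C|)%N.
  by have [P uP] := large_star r k; move/leq_trans; apply; apply/maxC/star_clique.
have [A0 CA0] : exists A, A \in C.
  by apply/card_gt0P; apply: leq_trans bigC; rewrite expn_gt0 (ltnW (finNzRing_gt1 R)).
(* Fewer reductions, each with at most [#|redker k|] members above it, would leave [C] smaller than
   the large star. *)
have small : ~ (#|S| < #|F| ^ k)%N.
  move=> lt; have := leq_trans bigC (clique_card (erefl _) unitT cC).
  apply/negP; rewrite -ltnNge; apply: leq_trans (card_redker k).
  rewrite mulnC ltn_pmul2l //; apply/card_gt0P; exists 0.
  by rewrite inE map_mx0.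
have q_gt1 := finNzRing_gt1 F.
have C_full D : clique grassmann_adj D -> C \subset D -> C = D.
  by move=> cD CD; apply/eqP; rewrite eqEcard CD maxC.
have SP X : X \in S -> exists2 A, A \in C & X = <<red (gmx A)>>%MS.
  by case/imsetP=> A; exists A.
have [||[P uP HP]|[Q uQ HQ]|Heq|[P [Q [fP fQ HPQ]]]] :=
  @clique_trichotomy {A | A \in C} r _ (fun A => gmx (val A)).
- by move=> A; apply: gmx_unim.
- move=> A B nBA; apply/adj_unim/cC; [exact: valP|exact: valP|].
  by apply: contra nBA => /eqP->.
- left; exists (rspan P); split; first exact: unim_subspace.
  apply: C_full; first exact: star_clique.
  apply/subsetP=> A CA; rewrite inE gmxE; apply/rspan_subP.
  exact: HP (exist _ A CA).
- right; split.
    exists (rspan Q); split; first exact: unim_subspace.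
    apply: C_full; first exact: top_clique.
    apply/subsetP=> A CA; rewrite inE gmxE; apply/rspan_subP.
    exact: HQ (exist _ A CA).
  rewrite leqNgt; apply/negP=> lt_rk; apply: small.
  (* With zero as lower space, all hyperplanes of [red Q] are counted. The exponent is [r.+2], at
     most [k] under [lt_rk]. *)
  have : (#|S| < #|F| ^ (\rank (red Q) - \rank (0%R : 'M[F]_(r.+1 + k))))%N.
    apply: card_hyperplanes_between => [|X /SP[A CA ->]]; first exact: sub0mx.
    split; rewrite ?genmx_id ?sub0mx ?genmxE //.
      by apply/msub_red/(HQ (exist _ A CA)).
    by rewrite (eqP (gmx_unim A)) (eqP uQ).
  by move/leq_trans; apply; rewrite (eqP uQ) mxrank0 subn0 leq_exp2l.
- case: small; apply: (@leq_ltn_trans 1); last by rewrite -(expn0 #|F|) ltn_exp2l // ltnW.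
  rewrite -(cards1 <<red (gmx A0)>>%MS); apply/subset_leq_card/subsetP=> _ /SP[A CA ->].
  rewrite inE; apply/eqP/genmxP.
  by rewrite (Heq (exist _ A CA) (exist _ A0 CA0)) (Heq (exist _ A0 CA0) (exist _ A CA)).
case: small.
have PQ : (P <= Q)%MS.
  by have [h1 h2] := HPQ (exist _ A0 CA0); apply: submx_trans h1 h2.
have : (#|S| < #|F| ^ (\rank Q - \rank P))%N.
  apply: card_hyperplanes_between => // X /SP[A CA ->].
  have [h1 h2] := HPQ (exist _ A CA).
  split; rewrite ?genmx_id ?genmxE //.
  by rewrite (eqP (gmx_unim A)) (eqP fQ).
(* For a pencil the exponent is 2, so [1 < k] suffices. *)
move/leq_trans; apply; rewrite (eqP fQ) (eqP fP) leq_exp2l //.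
by rewrite -addn2 addKn.
Qed.

End LocalRing.

(** * Matrix families with invertible nonzero combinations *)

(** [T l] is multiplication by the [l]-th basis vector of [L]. A nonzero combination is
    multiplication by a nonzero element, which is injective. *)
Lemma regular_family (K : fieldType) (L : fieldExtType K) k :
  \dim {: L} = k ->
  exists T : 'I_k -> 'M[K]_k,
    forall u : 'cV[K]_k, u != 0 -> \sum_l u l 0 *: T l \in unitmx.
Proof.
move=> dL; pose e := vbasis {: L}; move: (vbasisP {: L}); rewrite -/e => be.
move: e be; rewrite dL => e be; have /freeP fe := basis_free be.
exists (fun l => \matrix_(i, j) coord e j (e`_i * e`_l)) => u u0.
pose y := \sum_l u l 0 *: e`_l.
have y0 : y != 0.
  apply: contra u0 => /eqP/fe h; apply/eqP/colP=> l; by rewrite h mxE.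
rewrite -row_free_unit -kermx_eq0; apply/rowV0P=> v /sub_kermxP v0.
suff : (\sum_i v 0 i *: e`_i) * y == 0.
  by rewrite mulf_eq0 (negbTE y0) orbF => /eqP/fe h; apply/rowP=> i; rewrite h mxE.
rewrite (coord_basis be (memvf (_ * y))); apply/eqP/big1 => j _.
have /rowP/(_ j) := v0; rewrite !mxE => vj.
suff -> : coord e j ((\sum_i v 0 i *: e`_i) * y) = 0 by rewrite scale0r.
rewrite -[RHS]vj mulr_suml linear_sum /=; apply: eq_bigr => i _.
rewrite -scalerAl linearZ /=; congr (_ * _).
rewrite mulr_sumr linear_sum summxE; apply: eq_bigr => l _.
by rewrite -scalerAr linearZ !mxE.
Qed.

(** Keeps the first [r] of the [k] matrices given by the field with [p ^ k] elements; coefficients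
    are padded with zeros. *)
Lemma unit_combination_family p r k : prime p -> (0 < k)%N -> (r <= k)%N ->
  exists T : 'I_r -> 'M['F_p]_k,
    forall u : 'cV['F_p]_r, u != 0 -> \sum_l u l 0 *: T l \in unitmx.
Proof.
move=> p_pr k_gt0 le_rk; have [L chL cL] := pPrimePowerField p_pr k_gt0.
have [|T uT] := @regular_family 'F_p (pPrimeCharType chL) k.
  by rewrite pprimeChar_dimf cL pfactorK.
move: T uT; rewrite -(subnKC le_rk) => T uT.
exists (fun l => T (lshift _ l)) => u u0.
have := uT (col_mx u 0); rewrite big_split_ord /=.
under eq_bigr => l _ do rewrite col_mxEu.
under [X in _ + X]eq_bigr => l _ do rewrite col_mxEd mxE scale0r.
by rewrite big1_eq addr0; apply; apply: contra u0; rewrite col_mx_eq0 => /andP[].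
Qed.

(** * The ring of integers modulo [p ^ s] and its reduction modulo [p] *)

Section ModularReduction.
Variables p s : nat.
Hypotheses (p_pr : prime p) (s_gt0 : (0 < s)%N).

Let ps_gt1 : (1 < p ^ s)%N.
Proof. by rewrite -(exp1n s) ltn_exp2r ?prime_gt1. Qed.

Lemma natr_mod_Fp a : (a %% (Zp_trunc (p ^ s)).+2)%:R = a%:R :> 'F_p.
Proof.
rewrite (Zp_cast ps_gt1) [in RHS](divn_eq a (p ^ s)) natrD natrM natrX pchar_Fp_0 //.
by rewrite expr0n -[s == 0%N]negbK -lt0n s_gt0 mulr0 add0r.
Qed.

Definition Zp_red (x : 'Z_(p ^ s)) : 'F_p := (x : nat)%:R.

Fact Zp_red_is_zmod : zmod_morphism Zp_red.
Proof.
move=> x y; apply/eqP; rewrite eq_sym subr_eq; apply/eqP.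
rewrite /Zp_red -[RHS]natrD -[RHS]natr_mod_Fp; congr (_%:R).
by rewrite -{1}(subrK y x).
Qed.

Fact Zp_red_is_monoid : monoid_morphism Zp_red.
Proof.
split=> [|x y]; first by rewrite /Zp_red /= modn_small.
by rewrite /Zp_red -natrM -[RHS]natr_mod_Fp.
Qed.

HB.instance Definition _ :=
  GRing.isZmodMorphism.Build 'Z_(p ^ s) 'F_p Zp_red Zp_red_is_zmod.
HB.instance Definition _ :=
  GRing.isMonoidMorphism.Build 'Z_(p ^ s) 'F_p Zp_red Zp_red_is_monoid.

Lemma Zp_redK : cancel (fun y : 'F_p => (y : nat)%:R) Zp_red.
Proof.
move=> y; rewrite /Zp_red (val_Zp_nat ps_gt1) -{1}(Zp_cast ps_gt1).
by rewrite natr_mod_Fp natr_Zp.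
Qed.

Lemma unit_Zp_red x : Zp_red x != 0 -> x \is a GRing.unit.
Proof.
rewrite /Zp_red -(dvdn_pcharf (pchar_Fp p_pr)) -{2}[x]natr_Zp unitZpE //.
by rewrite coprime_pexpl // prime_coprime.
Qed.

(** The gcds with [p ^ s] are powers of [p], so the least of them divides every [f j]; it is itself
    a multiple of [f i] modulo [p ^ s]. *)
Lemma Zp_pow_chain q (f : 'I_q.+1 -> 'Z_(p ^ s)) :
  exists i, forall j, exists c, f j = c * f i.
Proof.
pose g j := gcdn (p ^ s) (f j).
have gX j : exists e, g j = (p ^ e)%N.
  by have /(dvdn_pfactor _ _ p_pr)[e _ ->] : (g j %| p ^ s)%N by [exact: dvdn_gcdl]; exists e.
case: (@arg_minnP _ ord0 predT g isT) => i _ min_i; exists i => j.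
have /dvdnP[d ed] : (g i %| f j)%N.
  apply: dvdn_trans (dvdn_gcdr (p ^ s) _); have := min_i j isT; rewrite -/(g j).
  by have [[e ->] [e' ->]] := (gX i, gX j); rewrite leq_exp2l ?prime_gt1 //; apply: dvdn_exp2l.
(* This form of Bezout makes [g i + a * f i] a multiple of [p ^ s], hence the sign in the
   witness. *)
have [a _ /dvdnP[b eb]] := Bezoutl (f i) (ltnW ps_gt1).
have ps0 : (p ^ s)%:R = 0 :> 'Z_(p ^ s) by apply: pchar_Zp.
exists (- (d * a)%:R); rewrite -{1}[f j]natr_Zp -[X in _ * X]natr_Zp ed natrM.
have : (g i)%:R + (a * f i)%:R = 0 :> 'Z_(p ^ s) by rewrite -natrD eb natrM ps0 mulr0.
by move/eqP; rewrite addr_eq0 => /eqP->; rewrite !natrM mulrN mulrA mulNr.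
Qed.

Lemma maximum_clique_Zp m n (C : {set grassmann 'Z_(p ^ s) n m}) :
  (1 < m)%N -> (2 * m <= n)%N -> maximum_clique grassmann_adj C ->
  is_star C \/ (is_top C /\ (n - m <= m)%N).
Proof.
move: C; case: m => // r C r_gt0; rewrite mul2n -addnn => le_n.
have en : (r.+1 + (n - r.+1))%N = n by rewrite subnKC // (leq_trans _ le_n) // leq_addr.
(* This inequality lets the field with [p ^ k] elements supply [r.+1] matrices, and with [1 < m] it
   gives [1 < k]. *)
have le_k : (r.+1 <= n - r.+1)%N by rewrite -(leq_add2l r.+1) en.
move: (n - r.+1)%N en le_k => k en le_k; move: C; rewrite -{n le_n}en => C maxC.
have [T uT] := unit_combination_family p_pr (leq_trans (ltn0Sn r) le_k) le_k.
exact: (@maximum_clique_star_or_top 'Z_(p ^ s) 'F_p Zp_red _ Zp_redK unit_Zp_red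
          r k T C Zp_pow_chain uT (leq_trans r_gt0 le_k) maxC).
Qed.

End ModularReduction.

Local Close Scope ring_scope.

Theorem theorem4p6 (p s m n : nat) (p_prime : prime p) (s_gt0 : 0 < s)
    (m_ge2 : 2 <= m) :
  (2 * m < n ->
     forall C : {set grassmann 'Z_(p ^ s) n m},
       maximum_clique grassmann_adj C -> is_star C) /\
  (n = 2 * m ->
     forall C : {set grassmann 'Z_(p ^ s) n m},
       maximum_clique grassmann_adj C -> is_star C \/ is_top C).
Proof.
split=> [lt_n C maxC|en C maxC].
  case: (maximum_clique_Zp p_prime s_gt0 m_ge2 (ltnW lt_n) maxC) => // -[_].
  by rewrite leq_subLR addnn -mul2n leqNgt lt_n.
have le_n : 2 * m <= n by rewrite en.
case: (maximum_clique_Zp p_prime s_gt0 m_ge2 le_n maxC) => [|[]]; first by left.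
by right.
Qed.
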